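(* Let $q=2^m$ with $m>1$. Let $c_1,c_2,c_3,\gamma\in\mathbb{F}_{q^2}$ with $c_2\in\mathbb{F}_{q^2}\setminus\mathbb{F}_q$ be such that $$f_1(x)=x+\gamma\,\mathrm{Tr}_q^{q^2}\bigl(c_1x+c_2x^2+c_3x^3+x^{q+2}\bigr)$$ is a permutation polynomial of $\mathbb{F}_{q^2}$, and let $$g(x)=x+\gamma'\,\mathrm{Tr}_q^{q^2}\bigl(c_1'x+c_2'x^2+c_3'x^3+x^{q+2}\bigr)$$ with $\gamma'\in\mathbb{F}_{q^2}^*$ and $c_1',c_2',c_3'\in\mathbb{F}_2$. Then $f_1$ and $g$ are not quasi-multiplicative (QM) equivalent over $\mathbb{F}_{q^2}$.
   Context: $\mathbb{F}_q$ denotes the finite field with $q$ elements, and $\mathbb{F}_{q^2}^*=\mathbb{F}_{q^2}\setminus\{0\}$. $\mathrm{Tr}_q^{q^2}:\mathbb{F}_{q^2}\to\mathbb{F}_q$ is the relative trace $\mathrm{Tr}_q^{q^2}(x)=x+x^q$. A polynomial is a permutation polynomial of $\mathbb{F}_{q^2}$ if it induces a bijection of $\mathbb{F}_{q^2}$. Two polynomials $f,g$ over $\mathbb{F}_{q^2}$ are QM equivalent over $\mathbb{F}_{q^2}$ if there exist an integer $1\le d<q^2-1$ with $\gcd(d,q^2-1)=1$ and elements $\alpha,\beta\in\mathbb{F}_{q^2}^*$ such that $f(X)=\alpha\,g(\beta X^d)$, the equality being understood as functions on $\mathbb{F}_{q^2}$ (equivalently, modulo $X^{q^2}-X$). *)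

(* Defs.v *)
From mathcomp Require Import all_boot all_order all_algebra all_field.

Set Implicit Arguments.
Unset Strict Implicit.
Unset Printing Implicit Defensive.

Import GRing.Theory.
Local Open Scope ring_scope.

Definition permutation_poly (F : finFieldType) (p : {poly F}) : Prop :=
  bijective (fun x : F => p.[x]).

Definition rel_trace (F : finFieldType) (q : nat) (x : F) : F := x + x ^+ q.

Definition rel_trace_poly (F : finFieldType) (q : nat) : {poly F} := 'X + 'X^q.

Definition trace_poly (F : finFieldType) (q : nat) (gamma c1 c2 c3 : F) :
    {poly F} :=
  'X + gamma *: (rel_trace_poly F q \Po
                   (c1 *: 'X + c2 *: 'X^2 + c3 *: 'X^3 + 'X^(q + 2))).

Lemma horner_trace_poly (F : finFieldType) (q : nat) (gamma c1 c2 c3 x : F) :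
  (trace_poly q gamma c1 c2 c3).[x] =
  x + gamma * rel_trace q (c1 * x + c2 * x ^+ 2 + c3 * x ^+ 3 + x ^+ (q + 2)).
Proof.
by rewrite /trace_poly hornerD hornerZ horner_comp /rel_trace_poly /rel_trace !hornerE.
Qed.

(* The equality of f and alpha * g(beta X^d) is one of functions on F, that is,
   modulo 'X^#|F| - 'X, not an equality in {poly F}. *)
Definition QM_equivalent (F : finFieldType) (f g : {poly F}) : Prop :=
  exists (d : nat) (alpha beta : F),
    [/\ (1 <= d < #|F| - 1)%N, coprime d (#|F| - 1),
        alpha != 0, beta != 0 &
        forall x : F, f.[x] = alpha * g.[beta * x ^+ d]].

(* Main.v *)
Require Import Defs.
From mathcomp Require Import all_boot all_order all_algebra all_field.
From mathcomp Require Import zify ring.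

Set Implicit Arguments.
Unset Strict Implicit.
Unset Printing Implicit Defensive.

Import GRing.Theory.
Local Open Scope ring_scope.

(** Put [N = q ^ 2 - 1].  Modulo ['X^N.+1 - 'X] both polynomials have exponents
    among [1, q, 2, 2q, 3, 3q, q + 2, 2q + 1], all smaller than [N].  Since
    functions on F agree on nonzero elements only if their reduced polynomials
    agree, an equivalence [f x = a * g (b * x ^ d)] is a system of coefficient
    equations [f_k = a * b ^ s(k) * g_{s(k)}], where [s(k)] is [k] times the
    inverse of [d] modulo [N] ([coef_monomial_substitution]).

    If [gamma = 0], then [f] is a monomial while [g] is not.  Otherwise [f] has
    nonzero coefficients at [2] and at [q + 2], so that [e = s(2)] and
    [u = s(q + 2)] are exponents of [g], linked by [(q + 2) e = 2 u] modulo
    [N].  This congruence has few solutions ([trace_support_match]): [e] is in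
    [{2, 2q}] and [u] in [{q + 2, 2q + 1}], except when [q = 4], where [e] in
    [{1, 4}] and [u] in [{3, 12}] is also possible.

    The rest exploits the conjugation [k |-> q k] on exponents, which commutes
    with [s].  The coefficients of [f] at [q + 2] and [2q + 1] are both [gamma]
    and the coefficients of [g] at [u] and [q u] are equal too, because [c3'] is
    fixed by the [q]-th power; hence [b ^ u = b ^ (q u)], and this forces
    [b ^ q = b].  If [e] is [2] or [2q], the coefficients of [g] at [e] and
    [q e] are also equal, as [c2'] is fixed, so those of [f] at [2] and [2q]
    agree and [c2 ^ q = c2], that is, [c2] is in [Fq].  In the exceptional case
    this symmetry of [g] is broken by the term ['X], but its coefficient at [4]
    alone shows that [c2] or its conjugate is [b * c1'], an element of [Fq]. *)

(** * Powers in a finite field and its subfields *)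

Lemma expf_card_pred (F : finFieldType) (x : F) : x != 0 -> x ^+ (#|F| - 1) = 1.
Proof.
move=> x0; apply: (mulfI x0).
by rewrite -exprS mulr1 subn1 prednK ?expf_card // (ltnW (finNzRing_gt1 F)).
Qed.

Lemma expf_mod_card (F : finFieldType) (x : F) (n : nat) :
  x != 0 -> x ^+ (n %% (#|F| - 1)) = x ^+ n.
Proof.
move=> x0; rewrite {2}(divn_eq n (#|F| - 1)) exprD mulnC exprM.
by rewrite expf_card_pred // expr1n mul1r.
Qed.

(** Multiplication by a nonzero [x] permutes the nonzero elements of [K], so it
    fixes their product. *)
Lemma expf_card_subfield (F : finFieldType) (K : {set F}) (x : F) :
  divring_closed K -> x \in K -> x ^+ #|K| = x.
Proof.
move=> [K1 KB KV] xK.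
have K0 : 0 \in K by rewrite -(subrr (1 : F)) KB.
have KVr y : y \in K -> y^-1 \in K by move=> yK; rewrite -div1r KV.
have KM y z : y \in K -> z \in K -> y * z \in K.
  by move=> yK zK; rewrite -[z]invrK KV // KVr.
have [-> | x0] := eqVneq x 0.
  rewrite expr0n; case: eqP => // /eqP; rewrite cards_eq0 => /eqP KE.
  by rewrite KE inE in K0.
rewrite (cardsD1 0 K) K0 exprS.
suff -> : x ^+ #|K :\ 0| = 1 by rewrite mulr1.
have P0 : \prod_(y in K :\ 0) y != 0.
  by apply/prodf_neq0 => y; rewrite !inE => /andP[].
apply: (mulIf P0); rewrite mul1r -prodr_const -big_split /=.
rewrite [RHS](reindex_inj (mulfI x0)) /=.
apply: eq_bigl => y; rewrite !inE mulf_eq0 (negbTE x0) /=.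
congr (_ && _); apply/idP/idP => [|yK]; first exact: KM.
by rewrite -(mulKf x0 y) KM // KVr.
Qed.

(** Otherwise [x] and the elements of [K] would be too many roots of
    ['X^#|K| - 'X]. *)
Lemma mem_subfield (F : finFieldType) (K : {set F}) (x : F) :
  divring_closed K -> x ^+ #|K| = x -> x \in K.
Proof.
move=> hK hx; apply/negPn/negP => xK.
have [K1 KB _] := hK.
have cK : (1 < #|K|)%N.
  rewrite (cardsD1 0) (cardsD1 1 (K :\ 0)) !inE oner_eq0 K1.
  by rewrite -(subrr (1 : F)) KB.
have sp : size ('X^#|K| - 'X : {poly F}) = #|K|.+1.
  by rewrite size_polyDl ?size_polyXn // size_polyN size_polyX.
have p0 : ('X^#|K| - 'X : {poly F}) != 0 by rewrite -size_poly_eq0 sp.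
have := max_poly_roots p0 (rs := x :: enum K).
rewrite /= enum_uniq mem_enum xK sp -cardE ltnn => H.
suff : false by []. apply: H => //.
rewrite rootE !hornerE hx subrr eqxx /=; apply/allP => y.
by rewrite mem_enum rootE !hornerE => yK; rewrite expf_card_subfield // subrr.
Qed.

(** * Coefficients under a monomial substitution *)

Lemma poly_eq_on_units (F : finFieldType) (f g : {poly F}) :
  (size f <= #|F| - 1)%N -> (size g <= #|F| - 1)%N ->
  (forall x : F, x != 0 -> f.[x] = g.[x]) -> f = g.
Proof.
move=> sf sg fg; apply/eqP; rewrite -subr_eq0; apply/negPn/negP => p0.
have := max_poly_roots p0 (rs := enum [set~ (0 : F)]).
rewrite enum_uniq -cardE cardsC1 -subn1 => H.
have : (#|F| - 1 < size (f - g)%R)%N.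
  apply: H => //; apply/allP => x; rewrite mem_enum !inE => x0.
  by rewrite rootE !hornerE fg // subrr.
rewrite ltnNge (leq_trans (size_polyD _ _)) // size_polyN.
by rewrite geq_max sf sg.
Qed.

Lemma coprime_inverse (d N : nat) : (0 < d)%N -> coprime d N ->
  {D : nat | d * D = 1 %[mod N]}.
Proof.
move=> d0 /eqP cop; have [D k dD _] := egcdnP N d0.
by exists D; rewrite mulnC dD cop modnMDl.
Qed.

(** Reducing the exponents [d * i] of [g(b 'X^d)] modulo [#|F| - 1] yields a
    polynomial small enough to be determined by its values on nonzero elements;
    as [d] is invertible modulo [#|F| - 1], no two terms are merged. *)
Lemma coef_monomial_substitution (F : finFieldType) (f g : {poly F})
    (d D : nat) (a b : F) (N := (#|F| - 1)%N) :
  d * D = 1 %[mod N] -> b != 0 ->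
  (size f <= N)%N -> (size g <= N)%N ->
  (forall x : F, x != 0 -> f.[x] = a * g.[b * x ^+ d]) ->
  forall k, (k < N)%N -> f`_k = a * b ^+ (D * k) * g`_(D * k %% N).
Proof.
move=> dD b0 sf sg fg k kN.
have N0 : (0 < N)%N by apply: leq_ltn_trans kN.
have dDK j : (d * (D * j) = j %[mod N])%N.
  by rewrite mulnA -modnMml dD modnMml mul1n.
have -> : f = \sum_(i < N) (a * b ^+ i * g`_i) *: 'X^(d * i %% N).
  apply: poly_eq_on_units => // [|x x0].
    apply: (leq_trans (size_sum _ _ _)); apply/bigmax_leqP => i _.
    by rewrite (leq_trans (size_scale_leq _ _)) // size_polyXn ltn_mod.
  rewrite fg // (horner_coef_wide _ sg) mulr_sumr horner_sum.
  apply: eq_bigr => i _; rewrite hornerZ hornerXn expf_mod_card //.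
  rewrite exprMn -exprM.
  by ring.
have DkN : (D * k %% N < N)%N by rewrite ltn_mod.
rewrite coef_sum (bigD1 (Ordinal DkN)) //= big1 ?addr0 => [|i].
  rewrite coefZ coefXn modnMmr dDK (modn_small kN) //.
  by rewrite eqxx mulr1 expf_mod_card.
rewrite coefZ coefXn => iD.
case: eqP => [kE|]; last by rewrite mulr0.
case/eqP: iD; apply: val_inj => /=.
by rewrite kE modnMmr mulnCA dDK modn_small.
Qed.

(** * Exponents of the trace polynomials *)

(** The exponents of [x + gamma * Tr (c1 x + c2 x^2 + c3 x^3 + x^(q + 2))] after
    reduction modulo [q ^ 2 - 1]. *)
Definition trace_support (q : nat) : seq nat :=
  [:: 1; q; 2; 2 * q; 3; 3 * q; q + 2; 2 * q + 1]%N.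

Lemma two_power_cases (m : nat) :
  (1 < m)%N -> (2 ^ m = 4)%N \/ (8 <= 2 ^ m)%N.
Proof.
case: m => [|[|[|m]]] // _; first by left.
by right; exact: (@leq_pexp2l 2 3).
Qed.

Lemma trace_support_bounds (q : nat) (N := (q ^ 2 - 1)%N) : (4 <= q)%N ->
  [/\ (0 < N)%N, (2 < N)%N, (2 * q < N)%N, (q + 2 < N)%N & (2 * q + 1 < N)%N].
Proof.
move=> q4; have : (3 * q < N)%N by rewrite /N; nia.
by move: N => N; split; lia.
Qed.

(** Multiplication by [q] is the conjugation of exponents: it exchanges the two
    terms [y] and [y ^+ q] of the trace of a monomial. *)
Lemma trace_support_conj (q : nat) (N := (q ^ 2 - 1)%N) : (4 <= q)%N ->
  [/\ (q * 2 %% N = 2 * q)%N, (q * (2 * q) %% N = 2)%N,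
      (q * (q + 2) %% N = 2 * q + 1)%N & (q * (2 * q + 1) %% N = q + 2)%N].
Proof.
move=> q4; have [_ N2 N2q Nq2 N2q1] := trace_support_bounds q4.
have qN : (q * q = N + 1)%N by rewrite /N; nia.
have red j r k : (r < N)%N -> (k = j * N + r)%N -> (k %% N = r)%N.
  by move=> rN ->; rewrite modnMDl modn_small.
rewrite -/N in N2 N2q Nq2 N2q1; move: N qN N2 N2q Nq2 N2q1 red =>
  N qN N2 N2q Nq2 N2q1 red.
split; [apply: (red 0%N) | apply: (red 2%N) | apply: (red 1%N)
  | apply: (red 2%N)] => //; nia.
Qed.

(** For [8 <= q], [(q + 2) * e] reduces modulo [q ^ 2 - 1] to at most [6 q + 3],
    and [2 * u] is at most [6 q]; both are below the modulus, so the congruence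
    is an equality and the cases can be listed.  The second alternative exists
    because [q + 2 = 2 * 3] for [q = 4]: doubling modulo 15 then permutes the
    support.  For that [q], coprimality excludes the multiples of 3. *)
Lemma trace_support_match (q e u : nat) :
  q = 4%N \/ (8 <= q)%N ->
  e \in trace_support q -> u \in trace_support q ->
  coprime e (q ^ 2 - 1) ->
  (q + 2) * e = 2 * u %[mod q ^ 2 - 1] ->
  (e \in [:: 2; 2 * q] /\ u \in [:: q + 2; 2 * q + 1])%N \/
  (q = 4 /\ e \in [:: 1; 4] /\ u \in [:: 3; 12])%N.
Proof.
case=> [-> | q8].
  rewrite !inE.
  by do 7?[case/orP]; move/eqP->; do 7?[case/orP]; move/eqP->;
     move=> // _; (try by left); right.
set N := (q ^ 2 - 1)%N; have qq : (q * q = N + 1)%N by rewrite /N; nia.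
have N7 : (7 * q + 7 <= N)%N by nia.
move=> eS uS _ euE; left.
have uN : (2 * u < N)%N.
  by move: uS; rewrite !inE; do 7?[case/orP]; move/eqP->; lia.
(* The values [j * N + r] below are the Euclidean divisions of [(q + 2) * e]. *)
have red j r : (r < N)%N -> ((q + 2) * e = j * N + r)%N -> (2 * u = r)%N.
  move=> rN eE; rewrite -(modn_small uN) -(modn_small rN) -euE eE.
  by rewrite modnMDl.
have ueE : (e, 2 * u)%N \in [:: (1, q + 2); (q, 2 * q + 1); (2, 2 * q + 4);
    (2 * q, 4 * q + 2); (3, 3 * q + 6); (3 * q, 6 * q + 3);
    (q + 2, 4 * q + 5); (2 * q + 1, 5 * q + 4)]%N.
  move: eS red; rewrite !inE !xpair_eqE.
  do 7?[case/orP]; move/eqP-> => red.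
  - by rewrite (red 0 (q + 2))%N ?eqxx ?orbT //; nia.
  - by rewrite (red 1 (2 * q + 1))%N ?eqxx ?orbT //; nia.
  - by rewrite (red 0 (2 * q + 4))%N ?eqxx ?orbT //; nia.
  - by rewrite (red 2 (4 * q + 2))%N ?eqxx ?orbT //; nia.
  - by rewrite (red 0 (3 * q + 6))%N ?eqxx ?orbT //; nia.
  - by rewrite (red 3 (6 * q + 3))%N ?eqxx ?orbT //; nia.
  - by rewrite (red 1 (4 * q + 5))%N ?eqxx ?orbT //; nia.
  - by rewrite (red 2 (5 * q + 4))%N ?eqxx ?orbT //; nia.
move: uS ueE; rewrite !inE !xpair_eqE {eS euE red uN qq N7}.
by lia.
Qed.

(** * The reduced trace polynomial *)

(** [Tr] is expanded with the Frobenius map, and [x^(q (q + 2))] is replaced by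
    [x^(2 q + 1)]; for [4 <= q] no exponent reaches [q ^ 2 - 1]. *)
Definition reduced_trace_poly (F : finFieldType) (q : nat) (gamma c1 c2 c3 : F)
    : {poly F} :=
  'X + gamma *: (c1 *: 'X + c1 ^+ q *: 'X^q + c2 *: 'X^2 + c2 ^+ q *: 'X^(2 * q)
    + c3 *: 'X^3 + c3 ^+ q *: 'X^(3 * q) + 'X^(q + 2) + 'X^(2 * q + 1)).

Lemma horner_reduced_trace_poly (F : finFieldType) (m q : nat)
    (gamma c1 c2 c3 x : F) :
  (q = 2 ^ m)%N -> #|F| = (q ^ 2)%N ->
  (reduced_trace_poly q gamma c1 c2 c3).[x] =
  (trace_poly q gamma c1 c2 c3).[x].
Proof.
move=> hq hF.
have ch : 2%N \in [pchar F].
  by apply: (@card_finPcharP _ _ (m * 2)) => //; rewrite hF hq expnM.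
have frob (y z : F) : (y + z) ^+ q = y ^+ q + z ^+ q.
  apply: exprDn_pchar; rewrite hq pnatX; apply/orP; left.
  by rewrite pnatE.
rewrite horner_trace_poly /rel_trace /reduced_trace_poly.
rewrite !(hornerD, hornerZ, hornerX, hornerXn) !frob.
have xx : x ^+ (q * q) = x by rewrite mulnn -hF expf_card.
have -> : (x ^+ (q + 2)) ^+ q = x ^+ (2 * q + 1).
  by rewrite -exprM mulnDl exprD xx exprD mulrC.
(* A general use of exprMn would also split [x ^+ 2] as a product. *)
have powM c k : (c * x ^+ k) ^+ q = c ^+ q * x ^+ (k * q).
  by rewrite exprMn exprM.
rewrite (exprMn _ c1) !powM.
by ring.
Qed.

(** Coefficients of a sum of monomials are sums of booleans [k == j]; linear
    arithmetic settles each of them. *)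
Ltac decide_nat_eqs :=
  repeat match goal with |- context [@eq_op ?T ?a ?b] =>
    first [have -> : @eq_op T a b = false by lia
          |have -> : @eq_op T a b = true by lia] end.

Lemma coef_reduced_trace_poly (F : finFieldType) (q : nat)
    (gamma c1 c2 c3 : F) (p := reduced_trace_poly q gamma c1 c2 c3) :
  (4 <= q)%N ->
  [/\ p`_q = gamma * c1 ^+ q, p`_2 = gamma * c2, p`_(2 * q) = gamma * c2 ^+ q,
      p`_3 = gamma * c3 & p`_(3 * q) = gamma * c3 ^+ q] /\
  p`_(q + 2) = gamma /\ p`_(2 * q + 1) = gamma.
Proof.
move=> q4; split; [split | split]; rewrite /p /reduced_trace_poly !coefE;
  by decide_nat_eqs; rewrite !(mulr0n, mulr1n); ring.
Qed.

Lemma size_reduced_trace_poly (F : finFieldType) (q : nat)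
    (gamma c1 c2 c3 : F) : (4 <= q)%N ->
  (size (reduced_trace_poly q gamma c1 c2 c3) <= q ^ 2 - 1)%N.
Proof.
move=> q4; apply/leq_sizeP => j hj.
have {}hj : (3 * q < j)%N by nia.
by rewrite !coefE; decide_nat_eqs; rewrite !mulr0n; ring.
Qed.

Lemma reduced_trace_poly_support (F : finFieldType) (q k : nat)
    (gamma c1 c2 c3 : F) :
  (reduced_trace_poly q gamma c1 c2 c3)`_k != 0 -> k \in trace_support q.
Proof.
apply: contraNT; rewrite !inE !negb_or.
case/and5P => /negbTE h1 /negbTE h2 /negbTE h3 /negbTE h4.
case/and4P => /negbTE h5 /negbTE h6 /negbTE h7 /negbTE h8.
by rewrite !coefE h1 h2 h3 h4 h5 h6 h7 h8 !mulr0n; apply/eqP; ring.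
Qed.

(** * Comparing the two polynomials *)

(* F is the field with q ^ 2 elements and Fq its subfield with q elements. *)
Theorem proposition5p3 (m q : nat) (F : finFieldType) (Fq : {set F})
    (c1 c2 c3 gamma c1' c2' c3' gamma' : F)
    (hm : (1 < m)%N) (hq : q = (2 ^ m)%N)
    (hF : #|F| = (q ^ 2)%N)
    (hFq : divring_closed Fq) (hFq_card : #|Fq| = q)
    (hc2 : c2 \notin Fq)
    (hf1 : permutation_poly (trace_poly q gamma c1 c2 c3))
    (hgamma' : gamma' != 0)
    (hc1' : c1' \in [set 0; 1])
    (hc2' : c2' \in [set 0; 1])
    (hc3' : c3' \in [set 0; 1]) :
  ~ QM_equivalent (trace_poly q gamma c1 c2 c3)
                  (trace_poly q gamma' c1' c2' c3').
Proof.
case=> d [a [b [/andP[d0 _] dcop a0 b0 fg]]].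
have [D dD] := coprime_inverse d0 dcop.
have q48 : q = 4%N \/ (8 <= q)%N.
  by rewrite hq; exact: two_power_cases.
have q4 : (4 <= q)%N by case: q48 => [-> // | /(leq_trans _)->].
set N := (q ^ 2 - 1)%N.
have [N0 N2 N2q Nq2 N2q1] := trace_support_bounds q4.
have [conj2 conj2q conjq2 conj2q1] := trace_support_conj q4.
rewrite -/N in N0 N2 N2q Nq2 N2q1 conj2 conj2q conjq2 conj2q1.
rewrite hF -/N in dcop dD.
have dDK k : (D * (d * k) = k %[mod N])%N.
  by rewrite mulnCA mulnA -modnMml dD modnMml mul1n.
have q_neq : (q + 2)%N <> (2 * q + 1)%N by clear -q4; lia.
pose f := reduced_trace_poly q gamma c1 c2 c3.
pose g := reduced_trace_poly q gamma' c1' c2' c3'.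
have fgE k : (k < N)%N -> f`_k = a * b ^+ (D * k) * g`_(D * k %% N).
  rewrite /N -hF; apply: (coef_monomial_substitution (d := d)) => //.
  - by rewrite hF.
  - by rewrite hF size_reduced_trace_poly.
  - by rewrite hF size_reduced_trace_poly.
  by move=> x _; rewrite !(horner_reduced_trace_poly _ _ _ _ _ hq hF).
have bmod k : b ^+ (k %% N) = b ^+ k by rewrite /N -hF expf_mod_card.
have [[_ f2 f2q _ _] [fq2 f2q1]] :=
  coef_reduced_trace_poly gamma c1 c2 c3 q4.
have [[gq g2 g2q g3 g3q] [gq2 g2q1]] :=
  coef_reduced_trace_poly gamma' c1' c2' c3' q4.
rewrite -/f -/g in f2 f2q fq2 f2q1 gq g2 g2q g3 g3q gq2 g2q1.
have bitq c : c \in [set (0 : F); 1] -> c ^+ q = c.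
  by rewrite !inE => /orP[] /eqP ->; rewrite ?expr1n // expr0n; case: (q) q4.
have [g0 | gamma0] := eqVneq gamma 0.
  (* Here [f = 'X], so [d] must send both [q + 2] and [2 * q + 1] to 1. *)
  have inv k : (k < N)%N -> g`_k != 0 -> (d * k %% N)%N = 1%N.
    move=> kN gk; have rN : (d * k %% N < N)%N by rewrite ltn_mod.
    have sE : (D * (d * k %% N) %% N = k)%N.
      by rewrite modnMmr dDK modn_small.
    have := fgE _ rN; rewrite sE.
    rewrite /f /reduced_trace_poly g0 scale0r addr0 coefX.
    case: eqP => // _ /esym/eqP; rewrite !mulf_eq0 (negbTE a0) (negbTE gk).
    by rewrite expf_eq0 (negbTE b0) andbF.
  have e1 : (d * (q + 2) %% N)%N = 1%N by apply: inv; rewrite ?gq2.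
  have e2 : (d * (2 * q + 1) %% N)%N = 1%N by apply: inv; rewrite ?g2q1.
  have := congr1 (fun k => D * k %% N)%N (etrans e1 (esym e2)).
  by rewrite /= !modnMmr !dDK !modn_small //.
have c20 : c2 != 0.
  apply: contraNneq hc2 => ->.
  by case: hFq => K1 KB _; rewrite -(subrr (1 : F)) KB.
(* It remains to show that [c2] is fixed by the [q]-th power. *)
case/negP: hc2; apply: mem_subfield; rewrite // hFq_card.
set e := (D * 2 %% N)%N; set u := (D * (q + 2) %% N)%N.
have f2E : gamma * c2 = a * b ^+ e * g`_e.
  by rewrite -f2 fgE; rewrite ?bmod.
have f2qE : gamma * c2 ^+ q = a * b ^+ (q * e) * g`_(q * e %% N).
  rewrite -f2q fgE //.
  by rewrite -[in RHS]bmod /e modnMmr bmod (mulnC 2) mulnCA.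
have fq2E : gamma = a * b ^+ u * g`_u.
  by rewrite -{1}fq2 fgE; rewrite ?bmod.
have f2q1E : gamma = a * b ^+ (q * u) * g`_(q * u %% N).
  rewrite -{1}f2q1 fgE //.
  rewrite -conjq2 -(bmod (D * _)%N) modnMmr bmod mulnCA.
  by rewrite -[in RHS](bmod (q * u)%N) /u modnMmr bmod.
have ge0 : g`_e != 0.
  apply: contraNneq (mulf_neq0 gamma0 c20) => ge; by rewrite f2E ge mulr0.
have gu0 : g`_u != 0.
  by apply: contraNneq gamma0 => gu; rewrite fq2E gu mulr0.
(* 2 and [D] are both invertible modulo the odd number [N]. *)
have ecop : coprime e N.
  have := coprime1n N; rewrite -coprime_modl -dD coprime_modl coprimeMl.
  case/andP => _ Dcop; rewrite coprime_modl coprimeMl Dcop coprime2n.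
  by rewrite oddB ?expn_gt0 ?(leq_trans _ q4) // oddX hq oddX; case: (m) hm.
have euE : ((q + 2) * e = 2 * u %[mod N])%N.
  by rewrite /e /u !modnMmr; congr (_ %% _)%N; ring.
have := trace_support_match q48 (reduced_trace_poly_support ge0)
  (reduced_trace_poly_support gu0) ecop euE.
(* The coefficients of [f] at [q + 2] and at its conjugate [2 * q + 1] agree. *)
have b_inj : g`_(q * u %% N) = g`_u -> b ^+ u = b ^+ (q * u).
  move=> gE; apply: (mulfI a0); apply: (mulIf gu0).
  by rewrite -fq2E {1}f2q1E gE.
case=> [[eE uE] | [q4E [eE uE]]].
  have bq : b ^+ q = b.
    have bE : b ^+ (q + 2) = b ^+ (2 * q + 1).
      move: uE b_inj; rewrite !inE => /orP[] /eqP ->.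
        by rewrite -(bmod (q * _)%N) conjq2 gq2 g2q1 => ->.
      by rewrite -(bmod (q * _)%N) conj2q1 gq2 g2q1 => ->.
    have bq1 : b ^+ (q + 1) != 0 by rewrite expf_neq0.
    apply: (mulfI bq1); rewrite -exprD -exprSr.
    by rewrite addnAC addnn -mul2n -addnS bE.
  apply: (mulfI gamma0); rewrite f2E f2qE exprM bq; congr (_ * _).
  move: eE; rewrite !inE => /orP[] /eqP ->.
    by rewrite conj2 g2 g2q bitq.
  by rewrite conj2q g2 g2q bitq.
(* The exceptional case: [q = 4] and [N = 15]. *)
clear hq hFq_card; subst q.
have b15 : b ^+ 15 = 1 by rewrite -(expf_card_pred b0) hF.
have b123 : b ^+ 12 = b ^+ 3.
  move: uE b_inj; rewrite !inE => /orP[] /eqP ->; rewrite -(bmod (4 * _)%N).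
    by rewrite [(4 * 3 %% N)%N]/(3 * 4)%N g3 g3q bitq // => ->.
  by rewrite (_ : 4 * 12 %% N = 3)%N // g3 (g3q : g`_12 = _) bitq // => ->.
have b9 : b ^+ 9 = 1.
  by apply: (mulIf (expf_neq0 3 b0)); rewrite -exprD b123 mul1r.
(* 3 is the gcd of 9 and 15; a cube root of unity lies in the field with 4
   elements. *)
have b3 : b ^+ 3 = 1.
  have b6 : b ^+ 6 = 1 by rewrite -b15 (exprD b 9 6) b9 mul1r.
  by rewrite -b9 (exprD b 6 3) b6 mul1r.
have b4 : b ^+ 4 = b by rewrite exprS b3 mulr1.
have gammaE : gamma = a * gamma'.
  have uE' : gamma = a * (gamma' * c3').
    rewrite {1}fq2E; move: uE; rewrite !inE => /orP[] /eqP ->.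
      by rewrite b3 mulr1 g3.
    by rewrite b123 b3 mulr1 (g3q : g`_12 = _) bitq.
  move: hc3' gamma0; rewrite {1}uE' !inE => /orP[] /eqP c3E.
    by rewrite uE' c3E !mulr0 eqxx.
  by rewrite uE' c3E mulr1.
(* The coefficient of [g] at 4 is [gamma' * c1'], as opposed to the one at 1,
   which also gets the term ['X]; the equation that involves the former shows
   that [c2] or its conjugate is [b * c1'], which is fixed by the fourth
   power. *)
have cancel_c2 x : gamma * x = a * b * (gamma' * c1') -> x = b * c1'.
  by move=> E; apply: (mulfI gamma0); rewrite E gammaE; ring.
have bc1 : (b * c1') ^+ 4 = b * c1' by rewrite exprMn b4 bitq.
move: eE f2E f2qE; rewrite !inE => /orP[] /eqP ->.
  rewrite (_ : 4 * 1 %% N = 4)%N // muln1 b4 gq (bitq _ hc1').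
  move=> _ /cancel_c2 c2E.
  have : c2 ^+ (4 * 4) = c2 by rewrite -[RHS]expf_card hF.
  by rewrite exprM c2E bc1.
by rewrite b4 gq (bitq _ hc1') => /cancel_c2 -> _.
Qed.
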